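(* Suppose $\operatorname{char}\mathcal{F}=0$ and fix $\alpha\in\mathcal{F}$, $\alpha\neq0$. Then $$\dim_{\mathcal H}\{x\in\mathcal{F}:|x|_\mathfrak{p}>1,\ ([\alpha x^n])_{n\ge1}\text{ is not uniformly distributed in }\mathcal{O}\}=1.$$
   Context: $\mathcal{F}$ is a non-Archimedean local field of characteristic $0$ (a finite extension of $\mathbb{Q}_p$) with valuation ring $\mathcal{O}$, maximal ideal $\mathfrak{p}$, $q=\#\mathcal{O}/\mathfrak{p}$, normalized absolute value $|\cdot|_\mathfrak{p}$, prime element $\pi$. Fix representatives $C\subset\mathcal{O}$ of $\mathcal{O}/\mathfrak{p}$ with $0\in C$; writing $x=\sum_{n\ge v}c_n\pi^n$ ($c_n\in C$), $[x]=\sum_{n\ge0}c_n\pi^n$. $D(a,r)=\{x:|x-a|_\mathfrak{p}\le r\}$. A sequence $(x_n)\subset\mathcal{O}$ is uniformly distributed in $\mathcal{O}$ if for all $a\in\mathcal{O}$, $k\in\mathbb{N}$, $\frac1N\#\{1\le n\le N:x_n\in D(a,q^{-k})\}\to q^{-k}$. Hausdorff dimension is with respect to the metric $|x-y|_\mathfrak{p}$. *)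

(* Defs.v *)
From HB Require Import structures.
From mathcomp Require Import all_boot all_order all_algebra.
From mathcomp Require Import all_classical all_reals all_analysis.
Set Implicit Arguments. Unset Strict Implicit. Unset Printing Implicit Defensive.
Import Order.TTheory GRing.Theory Num.Theory.
Import numFieldNormedType.Exports.
Local Open Scope classical_set_scope.
Local Open Scope ring_scope.

Section LocalField.
Variables (R : realType) (F : fieldType) (absp : F -> R).

(* Axioms of a non-Archimedean local field of characteristic 0 with
   normalized absolute value [absp], prime element [pi], residue field of
   cardinality [q], and a set [C] (containing 0) of representatives of O/p.
   (A complete discretely valued field of characteristic 0 with finite
   residue field is exactly a finite extension of Q_p.) *)
Definition is_char0_local_field (pi : F) (q : nat) (C : seq F) : Prop :=
     (forall x, 0 <= absp x) /\
     (forall x, absp x = 0 <-> x = 0) /\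
     (forall x y, absp (x * y) = absp x * absp y) /\
     (forall x y, absp (x + y) <= Num.max (absp x) (absp y)) /\
     (forall n : nat, (0 < n)%N -> (n%:R : F) != 0) /\
     (forall x, x != 0 -> exists n : nat,
          absp x = (q%:R ^+ n) \/ absp x = (q%:R ^+ n)^-1) /\
     absp pi = (q%:R)^-1 /\
     (forall u : nat -> F,
        (forall e : R, 0 < e -> exists N, forall m n, (N <= m)%N -> (N <= n)%N ->
             absp (u m - u n) < e) ->
        exists l, forall e : R, 0 < e -> exists N, forall n, (N <= n)%N ->
             absp (u n - l) < e) /\
     uniq C /\ size C = q /\ 0 \in C /\
     (forall c, c \in C -> absp c <= 1) /\
     (forall c c', c \in C -> c' \in C -> absp (c - c') < 1 -> c = c') /\
     (forall x, absp x <= 1 -> exists2 c, c \in C & absp (x - c) < 1).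

Definition frac_sums (pi : F) (C : seq F) : set F :=
  [set s | exists (m : nat) (d : nat -> F), (forall j, d j \in C) /\
      s = \sum_(1 <= j < m.+1) d j / pi ^+ j].

(* [x] = sum_{n>=0} c_n pi^n, i.e. x minus its (unique) negative-index part
   sum_{v<=n<0} c_n pi^n. *)
Definition int_part (pi : F) (C : seq F) (x : F) : F :=
  x - xget 0 [set s | frac_sums pi C s /\ absp (x - s) <= 1].

Definition unif_distr (q : nat) (u : nat -> F) : Prop :=
  forall a : F, absp a <= 1 -> forall k : nat,
    (fun N : nat =>
       (count (fun n => absp (u n - a) <= ((q%:R : R) ^+ k)^-1) (iota 1 N))%:R
         / (N%:R : R))
      @ \oo --> (((q%:R : R) ^+ k)^-1 : R).

Local Open Scope ereal_scope.

Definition diam (U : set F) : \bar R :=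
  ereal_sup [set (absp (x - y))%:E | x in U & y in U].

Definition hcontrib (s : R) (U : set F) : \bar R :=
  if `[< U = set0 >] then 0
  else match diam U with
       | r%:E => (r `^ s)%:E
       | _ => +oo
       end.

Definition hausdorff_delta (s delta : R) (A : set F) : \bar R :=
  ereal_inf [set \sum_(0 <= i <oo) hcontrib s (U i) |
     U in [set U : nat -> set F |
            A `<=` \bigcup_i U i /\ (forall i, diam (U i) <= delta%:E)]].

Definition hausdorff_measure (s : R) (A : set F) : \bar R :=
  ereal_sup [set hausdorff_delta s delta A | delta in [set d : R | (0 < d)%R]].

Definition hausdorff_dim (A : set F) : \bar R :=
  ereal_inf [set s%:E | s in [set s : R | (0 <= s)%R /\ hausdorff_measure s A = 0]].

End LocalField.

(* Main.v *)
(** Every subset of F has dimension at most 1, since a ball of radius q^m is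
    covered by q^n balls of radius q^(m-n).  For the lower bound, pick
    0 < M <= q with |M| < 1, so that every n_j = jM+1 has |n_j| = 1.  On the
    sphere |x| = q^L the map x |-> alpha x^(n_j) is then a similarity of ratio
    |alpha| q^(LMj) on each ball of radius < q^L, and it is onto at finite
    precision.  Going from n_j to n_(j+1), a ball therefore contains q^(LM-3)
    separated balls of radius q^(-LM) times smaller on which
    [alpha x^(n_(j+1))] lies in D(0, q^-3).  The resulting Cantor set has
    dimension at least 1 - 3/(LM), and each of its points x has
    [alpha x^n] in D(0, q^-3) for a proportion 1/M > q^-3 of the n.  Let L
    tend to infinity. *)

Require Import Defs.
From HB Require Import structures.
From mathcomp Require Import all_boot all_order all_algebra.
From mathcomp Require Import all_classical all_reals all_analysis.
From mathcomp Require Import ring lra zify.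
Import Order.TTheory GRing.Theory Num.Theory.
Local Open Scope classical_set_scope.
Local Open Scope ring_scope.

(** * Null sets of Hausdorff measures *)

Section Hausdorff.
Context (R : realType) (F : fieldType) (absp : F -> R).
Hypothesis absp_ge0 : forall x, 0 <= absp x.
Implicit Types (s : R) (U A : set F).
Local Open Scope ereal_scope.

Lemma hcontrib_ge0 s U : 0 <= hcontrib absp s U.
Proof.
rewrite /hcontrib; case: asboolP => // _.
by case: (diam _ _) => [r||]; rewrite ?leey ?lee_fin ?powR_ge0.
Qed.

Lemma hcontrib0 s : hcontrib absp s set0 = 0.
Proof. by rewrite /hcontrib asboolT. Qed.

Lemma diam_ge U x y : U x -> U y -> (absp (x - y))%:E <= diam absp U.
Proof. by move=> Ux Uy; apply: ereal_sup_ubound; exists x => //; exists y. Qed.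

Lemma hcontrib_le s r U : (0 <= s)%R -> (0 <= r)%R ->
  diam absp U <= r%:E -> hcontrib absp s U <= (r `^ s)%:E.
Proof.
move=> s0 r0 Ur; rewrite /hcontrib; case: asboolP => [_|].
  by rewrite lee_fin powR_ge0.
move=> /eqP/set0P[x Ux]; have := diam_ge _ _ _ Ux Ux.
have := absp_ge0 (x - x)%R; case: (diam absp U) Ur => [d||]//.
rewrite !lee_fin => dr x0 xd.
by apply: ge0_ler_powR => //; rewrite nnegrE (le_trans x0).
Qed.

(** Monotonicity of r^s read backwards. It later shows that a set of small weight cannot meet two
    well-separated balls. *)
Lemma hcontrib_lt_dist s r U x y : (0 <= s)%R -> (0 <= r)%R ->
  hcontrib absp s U < (r `^ s)%:E -> U x -> U y -> (absp (x - y) < r)%R.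
Proof.
move=> s0 r0; rewrite /hcontrib; case: asboolP => [-> //|_] + Ux Uy.
have := diam_ge _ _ _ Ux Uy; case: (diam absp U) => [d||]//.
rewrite lte_fin lee_fin => xyd; apply: contraPT.
rewrite -!leNgt => rxy; apply/negP; rewrite -leNgt.
by apply: ge0_ler_powR => //; rewrite ?nnegrE ?(le_trans rxy)// (le_trans r0)// (le_trans rxy).
Qed.

Lemma hausdorff_delta_ge0 s delta A : 0 <= hausdorff_delta absp s delta A.
Proof.
apply: le_ereal_inf_tmp => _ [U _ <-]; apply: nneseries_ge0 => *.
exact: hcontrib_ge0.
Qed.

Lemma hausdorff_measure_eq0 s A :
  hausdorff_measure absp s A = 0 <->
  (forall delta, (0 < delta)%R -> hausdorff_delta absp s delta A = 0).
Proof.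
split=> [A0 d d0|A0].
  apply/eqP; rewrite eq_le hausdorff_delta_ge0 andbT -A0.
  by apply: ereal_sup_ubound; exists d.
apply/eqP; rewrite eq_le; apply/andP; split.
  by apply: ge_ereal_sup => _ [d d0 <-]; rewrite A0.
by rewrite -(A0 1%R)//; apply: ereal_sup_ubound; exists 1%R => //=.
Qed.

Lemma subset_hausdorff_delta s delta A B : A `<=` B ->
  hausdorff_delta absp s delta A <= hausdorff_delta absp s delta B.
Proof.
move=> AB; apply: le_ereal_inf_tmp => _ [U [BU dU] <-].
by apply: ereal_inf_lbound; exists U => //; split => //; exact: subset_trans BU.
Qed.

Lemma hausdorff_delta0_cover s delta A e : (0 < e)%R ->
  hausdorff_delta absp s delta A = 0 ->
  exists U : nat -> set F, [/\ A `<=` \bigcup_i U i,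
    forall i, diam absp (U i) <= delta%:E &
    \sum_(0 <= i <oo) hcontrib absp s (U i) < e%:E].
Proof.
move=> e0 A0; have : hausdorff_delta absp s delta A < e%:E by rewrite A0 lte_fin.
by move=> /ereal_inf_lt[_ [U [AU dU] <-] Ue]; exists U.
Qed.

(** Cover the m-th set at cost below e / 2^(m+1), then merge the covers into one sequence. *)
Lemma hausdorff_delta_bigcup0 s delta (A : nat -> set F) :
  (forall m, hausdorff_delta absp s delta (A m) = 0) ->
  hausdorff_delta absp s delta (\bigcup_m A m) = 0.
Proof.
move=> A0; apply/eqP; rewrite eq_le hausdorff_delta_ge0 andbT.
apply/lee_addgt0Pr => e e0; rewrite add0e.
have en m : (0 < e / (2 ^ m.+1)%:R)%R by rewrite divr_gt0// ltr0n expn_gt0.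
have /choice[G PG] := fun m => hausdorff_delta0_cover s delta (A m) _ (en m) (A0 m).
(* The bijection [f] from [nat] to [nat * nat] enumerates the doubly indexed cover. *)
have /card_esym/ppcard_eqP[f] := card_nat2.
have h0 x : 0 <= hcontrib absp s (uncurry G x) by exact: hcontrib_ge0.
apply: (@le_trans _ _ (\esum_(i in setT) hcontrib absp s (uncurry G i))).
  apply: ereal_inf_lbound; exists (uncurry G \o f).
    split=> [x [m _ Amx]|i]; last first.
      by rewrite /= /uncurry; case: (f i) => a b; have [_ + _] := PG a; apply.
    have [/(_ _ Amx)[k _ Gx] _ _] := PG m.
    by exists (f^-1%FUN (m, k)) => //=; rewrite invK ?inE.
  by rewrite -(esum_pred_image (fun x => hcontrib absp s (uncurry G x)) _ xpredT)
    ?[fun=> _]set_true// image_eq.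
have -> : \esum_(i in setT) hcontrib absp s (uncurry G i) =
    \sum_(0 <= i <oo) \sum_(0 <= j <oo) hcontrib absp s (G i j).
  rewrite nneseries_esumT; last first.
    by move=> *; apply: nneseries_ge0 => *; exact: hcontrib_ge0.
  transitivity (\esum_(i in setT) \esum_(j in setT) hcontrib absp s (G i j)).
    rewrite esum_esum; last by move=> *; exact: hcontrib_ge0.
    by rewrite (_ : _ `*`` _ = setT)//; [apply: eq_esum => -[]|apply/seteqP; split].
  by apply: eq_esum => i _; rewrite nneseries_esumT// => *; exact: hcontrib_ge0.
apply: le_trans (epsilon_trick0 xpredT (ltW e0)).
apply: lee_nneseries => [i _ _|i _ /=].
  by apply: nneseries_ge0 => *; exact: hcontrib_ge0.
by have [_ _ /ltW] := PG i.
Qed.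

End Hausdorff.

Lemma exists_geo_lt (R : realType) (a t e : R) : 0 < t -> t < 1 -> 0 < e ->
  exists N, forall n, (N <= n)%N -> a * t ^+ n < e.
Proof.
move=> t0 t1 e0.
have := @cvg_geometric R a t; rewrite (gtr0_norm t0) => /(_ t1)/cvgrPdist_lt/(_ _ e0).
case=> N _ HN; exists N => n /HN /=; rewrite sub0r normrN.
by apply: le_lt_trans; exact: ler_norm.
Qed.

(** * Ultrametric absolute value and completeness *)

Section LocalField.
Context (R : realType) (F : fieldType) (absp : F -> R).
Context (pi : F) (q : nat) (C : seq F).
Hypothesis hF : is_char0_local_field absp pi q C.

Lemma absp_ge0 x : 0 <= absp x.
Proof. by case: hF. Qed.

Lemma absp0 : absp 0 = 0.
Proof. by case: hF => _ [h _]; apply/h. Qed.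

Lemma absp_gt0 x : (0 < absp x) = (x != 0).
Proof.
rewrite lt_neqAle absp_ge0 andbT eq_sym; congr (~~ _).
by case: hF => _ [h _]; apply/eqP/eqP => /h.
Qed.

Lemma abspM x y : absp (x * y) = absp x * absp y.
Proof. by case: hF => _ [_ [h _]]. Qed.

Lemma abspD_le x y r : absp x <= r -> absp y <= r -> absp (x + y) <= r.
Proof.
move=> xr yr; have [_ [_ [_ [/(_ x y) h _]]]] := hF.
by rewrite (le_trans h)// ge_max xr yr.
Qed.

Lemma absp1 : absp 1 = 1.
Proof.
have n0 : absp 1 != 0 by rewrite gt_eqF// absp_gt0 oner_eq0.
by apply: (mulfI n0); rewrite -abspM !mulr1.
Qed.

Lemma abspX x n : absp (x ^+ n) = absp x ^+ n.
Proof. by elim: n => [|n IH]; rewrite ?expr0 ?absp1// !exprS abspM IH. Qed.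

Lemma abspN x : absp (- x) = absp x.
Proof.
suff -> : absp (- x) = absp (-1) * absp x.
  suff -> : absp (-1) = 1 by rewrite mul1r.
  apply/eqP; rewrite -(@pexpr_eq1 _ _ 2) ?absp_ge0//.
  by rewrite -abspX sqrrN expr1n absp1.
by rewrite -abspM mulN1r.
Qed.

Lemma abspV x : absp x^-1 = (absp x)^-1.
Proof.
have [->|x0] := eqVneq x 0; first by rewrite !(invr0, absp0).
have n0 : absp x != 0 by rewrite gt_eqF// absp_gt0.
by apply: (mulfI n0); rewrite -abspM !divff// absp1.
Qed.

Lemma absp_distC x y : absp (x - y) = absp (y - x).
Proof. by rewrite -abspN opprB. Qed.

Lemma absp_dist_le z x y r :
  absp (x - z) <= r -> absp (z - y) <= r -> absp (x - y) <= r.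
Proof. by move=> xz zy; rewrite -(subrKA z) abspD_le. Qed.

(** Ultrametric triangles are isosceles. This keeps every point of the construction on one
    sphere. *)
Lemma absp_dist_eq x y : absp (x - y) < absp x -> absp y = absp x.
Proof.
move=> xyx; have [yx|xy|//] := ltgtP (absp y) (absp x).
  have : absp x <= Num.max (absp (x - y)) (absp y).
    by rewrite -{1}(subrK y x) abspD_le// le_max lexx ?orbT.
  by rewrite le_max !leNgt xyx yx.
have : absp y <= absp x.
  by rewrite -(subKr x y) abspD_le// abspN ltW.
by rewrite leNgt xy.
Qed.

(** 0 and the representative of the class of 1 are two distinct elements of [C]. *)
Lemma q_gt1 : (1 < q)%N.
Proof.
have [_ [_ [_ [_ [_ [_ [_ [_ [_ [<- [C0 [_ [_ hC]]]]]]]]]]]]] := hF.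
have [c cC c1] : exists2 c, c \in C & absp (1 - c) < 1 by apply: hC; rewrite absp1.
have c0 : c != 0 by apply: contraTneq c1 => ->; rewrite subr0 absp1 ltxx.
have : (size [:: 0%R; c] <= size C)%N.
  apply: uniq_leq_size => [|x]; first by rewrite /= inE eq_sym c0.
  by rewrite !inE => /orP[] /eqP->.
by [].
Qed.

Lemma qR_gt1 : 1 < q%:R :> R.
Proof. by rewrite ltr1n q_gt1. Qed.

Lemma qR_gt0 : 0 < q%:R :> R.
Proof. by rewrite (lt_trans _ qR_gt1). Qed.

Lemma absp_pi : absp pi = q%:R^-1.
Proof. by have [_ [_ [_ [_ [_ [_ [-> _]]]]]]] := hF. Qed.

Lemma pi_neq0 : pi != 0.
Proof. by rewrite -absp_gt0 absp_pi invr_gt0 qR_gt0. Qed.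

Lemma absp_lt1 x : absp x < 1 -> absp x <= q%:R^-1.
Proof.
have [->|x0 x1] := eqVneq x 0; first by rewrite absp0 invr_ge0 ltW ?qR_gt0.
have [_ [_ [_ [_ [_ [/(_ x x0)[n [e|e]] _]]]]]] := hF.
  by move: x1; rewrite e ltNge exprn_ege1// ltW// qR_gt1.
case: n e x1 => [->|n -> _]; first by rewrite expr0 invr1 ltxx.
rewrite lef_pV2 ?posrE ?exprn_gt0 ?qR_gt0//.
by rewrite exprS ler_peMr ?exprn_ege1 ?ltW ?qR_gt1 ?qR_gt0.
Qed.

(** By the ultrametric inequality a tail is bounded by its largest increment, so the error bound is
    r t^n without a factor 1 / (1 - t). *)
Lemma absp_complete (u : nat -> F) (r t : R) : 0 < t -> t < 1 -> 0 < r ->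
  (forall n, absp (u n.+1 - u n) <= r * t ^+ n) ->
  exists l, forall n, absp (l - u n) <= r * t ^+ n.
Proof.
move=> t0 t1 r0 hu.
have uD n k : absp (u (n + k)%N - u n) <= r * t ^+ n.
  elim: k => [|k IH].
    by rewrite addn0 subrr absp0 mulr_ge0 ?exprn_ge0// ltW.
  rewrite addnS; apply: absp_dist_le IH; apply: le_trans (hu _) _.
  rewrite ler_pM2l// exprD ler_piMr ?exprn_ge0 ?(ltW t0)//.
  by rewrite exprn_ile1 ?ltW.
have [_ [_ [_ [_ [_ [_ [_ [/(_ u) hc _]]]]]]]] := hF.
have [|l hl] := hc.
  move=> e e0; have [N HN] := exists_geo_lt _ r _ _ t0 t1 e0.
  exists N => m n Nm Nn; apply: le_lt_trans (HN N (leqnn _)).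
  apply: (absp_dist_le (u N)); first by rewrite -(subnKC Nm) uD.
  by rewrite absp_distC -(subnKC Nn) uD.
exists l => n; have rn : 0 < r * t ^+ n by rewrite mulr_gt0 ?exprn_gt0.
have [N HN] := hl _ rn; apply: (absp_dist_le (u (n + N)%N)) => //.
by rewrite absp_distC ltW// HN// leq_addl.
Qed.

(* Mass distribution principle without a measure: if the sets U_i cover A with
   small total weight, then by averaging one can descend to a child ball whose
   weight w (that of the U_i meeting it) drops by the factor #|I|.  This bound
   keeps every U_i meeting the current ball smaller than the gaps between the
   children, so that it meets at most one of them.  The limit point lies in A
   and in some U_i, whose weight would have to vanish. *)
Lemma hausdorff_measure_neq0 (I : finType) (G : nat -> F -> Prop)
    (s r t : R) (x0 : F) (A : set F) :
  0 <= s -> 0 < r -> 0 < t -> t < 1 ->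
  (1 < #|I|)%N -> 1 <= #|I|%:R * t `^ s ->
  G 0%N x0 ->
  (forall j x, G j x -> exists y : I -> F,
    [/\ forall i, absp (y i - x) <= r * t ^+ j,
        forall i, G j.+1 (y i) &
        forall i i', i != i' -> r * t ^+ j.+1 < absp (y i - y i')]) ->
  (forall x (y : nat -> F), y 0%N = x0 -> (forall j, G j (y j)) ->
    (forall j, absp (x - y j) <= r * t ^+ j) -> A x) ->
  hausdorff_measure absp s A <> 0%E.
Proof.
move=> s0 r0 t0 t1 I1 Its G0 GS GA mA0.
have N0 : 0 < #|I|%:R :> R by rewrite ltr0n ltnW.
pose k := (r * t) `^ s.
have k0 : 0 < k by rewrite powR_gt0 ?mulr_gt0.
(* Follows from #|I| t^s >= 1: a weight below k / #|I|^j forces a diameter below the gap between the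
   children of a level-j ball. *)
have kle j : k / #|I|%:R ^+ j <= (r * t ^+ j.+1) `^ s.
  rewrite exprS mulrA powRM ?exprn_ge0 ?mulr_ge0 ?(ltW r0) ?(ltW t0)// -/k.
  rewrite ler_pM2l// -[t ^+ j]powR_mulrn ?(ltW t0)// powRAC powR_mulrn ?powR_ge0//.
  by rewrite -exprVn lerXn2r ?nnegrE ?invr_ge0 ?powR_ge0 ?(ltW N0)//
    -[leLHS]mulr1 ler_pdivrMl.
have /(hausdorff_measure_eq0 _ _ _ s A)/(_ _ ltr01) dA0 := mA0.
(* Half of the budget [k] pays for the cover, the other half for the positive terms added in [c]. *)
have k20 : 0 < k / 2 by rewrite divr_gt0.
have [U [AU _ Uk]] := hausdorff_delta0_cover _ _ _ _ _ _ _ k20 dA0.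
(* The second term makes every weight positive, even that of a singleton. *)
pose c i := (hcontrib absp s (U i) + (k / 2 / (2 ^ i.+1)%:R)%:E)%E.
have e0 i : 0 < k / 2 / (2 ^ i.+1)%:R by rewrite divr_gt0// ltr0n expn_gt0.
have c0 i : (0 <= c i)%E by rewrite adde_ge0 ?hcontrib_ge0 ?lee_fin ?ltW.
have ck : (\sum_(0 <= i <oo) c i < k%:E)%E.
  rewrite nneseriesD; last 2 first.
  - by move=> *; exact: hcontrib_ge0.
  - by move=> *; rewrite lee_fin ltW.
  apply: le_lt_trans (leeD2l _ (epsilon_trick0 xpredT (ltW k20))) _.
  by rewrite [in ltRHS](splitr k) EFinD lteD2rE.
pose meets i j x := `[< exists2 z, U i z & absp (z - x) <= r * t ^+ j >].
pose w j x := (\sum_(0 <= i <oo) if meets i j x then c i else 0)%E.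
have c'0 j x i : (0 <= if meets i j x then c i else 0)%E by case: ifP.
have c_le i j x : meets i j x -> (c i <= w j x)%E.
  move=> mij; rewrite /w (@nneseriesD1 _ _ i)//= mij leeDl//.
  by apply: nneseries_ge0.
have step j x : G j x -> (w j x < (k / #|I|%:R ^+ j)%:E)%E ->
    exists y, [/\ G j.+1 y, absp (y - x) <= r * t ^+ j &
                (w j.+1 y < (k / #|I|%:R ^+ j.+1)%:E)%E].
  move=> Gx wx; have [y [yx Gy ysep]] := GS j x Gx.
  apply: contrapT => noy.
  have wy d : ((k / #|I|%:R ^+ j.+1)%:E <= w j.+1 (y d))%E.
    rewrite leNgt; apply/negP => wd; apply: noy.
    by exists (y d); split.
  (* Termwise: each [U i] counts for at most one child, and only if it already counts for the
     parent. *)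
  have sum_le : (\sum_(d in I) w j.+1 (y d) <= w j x)%E.
    rewrite /w -nneseries_sum//; apply: lee_nneseries => [i _ _|i _ /=].
      by rewrite sume_ge0.
    have [[d0 m0]|nom] := pselect (exists d0, meets i j.+1 (y d0)); last first.
      by rewrite big1// => d _; case: ifP => // md; case: nom; exists d.
    have [z Uz zd0] := asboolW m0.
    have mx : meets i j x.
      apply/asboolP; exists z => //; apply: (absp_dist_le (y d0)) => //.
      apply: le_trans zd0 _.
      by rewrite ler_pM2l// exprS ler_piMl ?exprn_ge0// ltW.
    rewrite (bigD1 d0)//= m0 mx big1 ?adde0// => d dd0.
    case: ifP => // md; have [z' Uz' zd] := asboolW md.
    (* If [U i] met the children [d0] and [d], its points [z] and [z'] would be closer than the gap,
       against [ysep]. *)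
    have hc : (hcontrib absp s (U i) < ((r * t ^+ j.+1) `^ s)%:E)%E.
      apply: (@le_lt_trans _ _ (c i)); first by rewrite leeDl// lee_fin ltW.
      apply: le_lt_trans (c_le _ _ _ mx) _; apply: lt_le_trans wx _.
      by rewrite lee_fin.
    have rj0 : 0 <= r * t ^+ j.+1 by rewrite mulr_ge0 ?exprn_ge0// ltW.
    have zz := hcontrib_lt_dist _ _ _ _ _ _ _ _ s0 rj0 hc Uz' Uz.
    have := ysep _ _ dd0; rewrite ltNge => /negP[].
    apply: (absp_dist_le z'); first by rewrite absp_distC.
    by apply: (absp_dist_le z) => //; exact: ltW.
  (* If no child were light enough, the parent would weigh at least #|I| * k / #|I|^(j+1) = k /
     #|I|^j, against [wx]. *)
  have : (\sum_(d in I) (k / #|I|%:R ^+ j.+1)%:E <= w j x)%E.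
    by apply: le_trans sum_le; apply: lee_sum => d _.
  rewrite sumEFin sumr_const -[_ *+ _]mulr_natr exprS invfM mulrA mulrAC divfK.
    by rewrite leNgt wx.
  by rewrite gt_eqF.
pose P j x := G j x /\ (w j x < (k / #|I|%:R ^+ j)%:E)%E.
(* [P] stands inside the relation to make it total; off [P] the value 0 is a dummy. *)
have /choice[f hf] : forall p : nat * F, exists y, P p.1 p.2 ->
    P p.1.+1 y /\ absp (y - p.2) <= r * t ^+ p.1.
  move=> [j x]; have [[Gx wx]|nP] := pselect (P j x); last by exists 0.
  by have [y [Gy yx wy]] := step j x Gx wx; exists y.
pose y := fix y n := if n is n'.+1 then f (n', y n') else x0.
have Py n : P n (y n).
  elim: n => [|n IH]; last by have [] := hf (n, y n) IH.
  split=> //=; rewrite expr0 divr1; apply: le_lt_trans ck.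
  by apply: lee_nneseries => // i _; case: ifP.
have [l hl] : exists l, forall n, absp (l - y n) <= r * t ^+ n.
  by apply: absp_complete => // n; have [] := hf (n, y n) (Py n).
have /AU[i _ Ul] : A l by apply: (GA l y) => // j; have [] := Py j.
(* [U i] contains the limit [l], hence meets every chosen ball, so the fixed positive weight [c i]
   is below k / #|I|^N for every N. *)
have [||] := exists_geo_lt _ k #|I|%:R^-1 _ _ _ (e0 i).
- by rewrite invr_gt0.
- by rewrite invf_lt1// ltr1n.
move=> N /(_ N (leqnn _)); rewrite exprVn => kN.
have : (c i < (k / #|I|%:R ^+ N)%:E)%E.
  have [_] := Py N; apply: le_lt_trans; apply: c_le; apply/asboolP.
  by exists l.
have : ((k / 2 / (2 ^ i.+1)%:R)%:E <= c i)%E by rewrite leeDr ?hcontrib_ge0.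
by move=> /le_lt_trans/[apply]; rewrite lte_fin => /(lt_trans kN); rewrite ltxx.
Qed.

#[local] Hint Resolve absp_ge0 q_gt1 qR_gt1 qR_gt0 pi_neq0 : core.

(** * Ball coverings and the upper bound on the dimension *)

Lemma absp_sum_le (I : Type) (l : seq I) (P : pred I) (f : I -> F) r :
  0 <= r -> (forall i, P i -> absp (f i) <= r) ->
  absp (\sum_(i <- l | P i) f i) <= r.
Proof.
move=> r0 fr; apply: (big_ind (fun x => absp x <= r)) => //.
  by rewrite absp0.
by move=> x y; exact: abspD_le.
Qed.

Lemma size_C : size C = q.
Proof. by have [_ [_ [_ [_ [_ [_ [_ [_ [_ [-> _]]]]]]]]]] := hF. Qed.

Lemma uniq_C : uniq C.
Proof. by have [_ [_ [_ [_ [_ [_ [_ [_ [-> _]]]]]]]]] := hF. Qed.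

Lemma C0 : 0 \in C.
Proof. by have [_ [_ [_ [_ [_ [_ [_ [_ [_ [_ [-> _]]]]]]]]]]] := hF. Qed.

Lemma absp_C c : c \in C -> absp c <= 1.
Proof. by have [_ [_ [_ [_ [_ [_ [_ [_ [_ [_ [_ [h _]]]]]]]]]]]] := hF; exact: h. Qed.

Lemma absp_C_neq c c' : c \in C -> c' \in C -> c != c' -> 1 <= absp (c - c').
Proof.
move=> cC c'C; apply: contraNle => cc'; apply/eqP.
by have [_ [_ [_ [_ [_ [_ [_ [_ [_ [_ [_ [_ [h _]]]]]]]]]]]]] := hF; exact: h.
Qed.

Lemma exists_digit x : absp x <= 1 -> exists2 c, c \in C & absp (x - c) <= q%:R^-1.
Proof.
have [_ [_ [_ [_ [_ [_ [_ [_ [_ [_ [_ [_ [_ h]]]]]]]]]]]]] := hF.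
by move=> /h[c cC /absp_lt1]; exists c.
Qed.

Lemma absp_le_expq x : exists n, absp x <= q%:R ^+ n.
Proof.
have [->|x0] := eqVneq x 0; first by exists 0%N; rewrite absp0.
have [_ [_ [_ [_ [_ [/(_ x x0)[n [->|->]] _]]]]]] := hF; first by exists n.
by exists 0%N; rewrite expr0 invf_le1 ?exprn_gt0// exprn_ege1// ltW.
Qed.

(** Subtracting c a, with [c] the digit of x / a, moves x into the ball of radius |a pi|; each of
    the n rounds multiplies the number of centres by q. *)
Lemma ball_cover (a : F) n : a != 0 -> exists l : seq F,
  size l = (q ^ n)%N /\
  forall x, absp x <= absp a -> exists2 y, y \in l & absp (x - y) <= absp a / q%:R ^+ n.
Proof.
elim: n a => [|n IH] a a0.
  exists [:: 0%R]; split=> // x xa; exists 0; rewrite ?inE//.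
  by rewrite subr0 expr0 divr1.
have [|l [sl hl]] := IH (a * pi); first by rewrite mulf_neq0.
exists [seq c * a + y | c <- C, y <- l]; split.
  by rewrite size_allpairs sl size_C expnS.
move=> x xa; have a0' : 0 < absp a by rewrite absp_gt0.
have [|c cC xc] := exists_digit (x / a).
  by rewrite abspM abspV ler_pdivrMr// mul1r.
have [|y yl xy] := hl (x - c * a).
  by rewrite -{1}(divfK a0 x) -mulrBl abspM mulrC abspM absp_pi ler_pM2l.
exists (c * a + y); first by apply/allpairsP; exists (c, y).
by move: xy; rewrite abspM absp_pi -addrA -opprD exprS invfM mulrA.
Qed.

Lemma diam_ball_le a r U : (forall x, U x -> absp (x - a) <= r) ->
  (diam absp U <= r%:E)%E.
Proof.
move=> Ur; apply: ge_ereal_sup => _ [x Ux [y Uy <-]]; rewrite lee_fin.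
by apply: (absp_dist_le a); rewrite ?Ur// absp_distC Ur.
Qed.

Lemma hausdorff_delta_ball_le s delta (a : F) n : 0 <= s -> a != 0 ->
  absp a / q%:R ^+ n <= delta ->
  (hausdorff_delta absp s delta [set x | absp x <= absp a]%R
     <= (q%:R ^+ n * (absp a / q%:R ^+ n) `^ s)%:E)%E.
Proof.
move=> s0 a0 ad; have [l [sl hl]] := ball_cover a n a0.
set r := absp a / _ in ad hl *.
have r0 : 0 <= r by rewrite divr_ge0 ?exprn_ge0 ?(ltW qR_gt0).
pose U i := if (i < size l)%N then [set x | absp (x - nth 0 l i) <= r] else set0.
have Ur i : (diam absp (U i) <= r%:E)%E.
  by apply: (diam_ball_le (nth 0 l i)) => x; rewrite /U; case: ifP.
rewrite /hausdorff_delta; apply: ge_ereal_inf; exists (\sum_(0 <= i <oo) hcontrib absp s (U i))%E.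
  exists U => //; split; last by move=> i; rewrite (le_trans (Ur i)) ?lee_fin.
  move=> x /hl[y yl xy]; exists (index y l) => //.
  by rewrite /U index_mem yl /= nth_index.
rewrite (nneseries_split 0 (size l)); last by move=> *; exact: hcontrib_ge0.
rewrite add0n eseries0 ?adde0; last first.
  by move=> i li _; rewrite /U ltnNge li /= hcontrib0.
apply: (@le_trans _ _ (\sum_(0 <= i < size l) (r `^ s)%:E)%E).
  by apply: lee_sum => i _; exact: hcontrib_le.
by rewrite sumEFin sumr_const_nat subn0 sl -[_ *+ (q ^ n)%N]mulr_natl natrX.
Qed.

(** F is a countable union of balls, and covering one of radius |a| by q^n smaller balls costs |a|^s
    q^(n (1 - s)), which tends to 0. *)
Lemma hausdorff_measure_gt1 s A : 1 < s -> hausdorff_measure absp s A = 0%E.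
Proof.
move=> s1; apply/hausdorff_measure_eq0 => // delta d0.
apply/eqP; rewrite eq_le hausdorff_delta_ge0 andbT.
have s0 : 0 <= s by rewrite ltW// (lt_trans _ s1).
pose B m := [set x : F | absp x <= absp ((pi^-1) ^+ m)].
apply: (@le_trans _ _ (hausdorff_delta absp s delta (\bigcup_m B m))).
  apply: subset_hausdorff_delta => x _; have [m xm] := absp_le_expq x.
  by exists m => //; rewrite /B /= abspX abspV absp_pi invrK.
rewrite hausdorff_delta_bigcup0// => m.
rewrite /B; set a := pi^-1 ^+ m; have a0 : a != 0 by rewrite expf_neq0// invr_neq0.
apply/eqP; rewrite eq_le hausdorff_delta_ge0 andbT; apply/lee_addgt0Pr => e e0.
have t0 : 0 < (q%:R : R) `^ (1 - s) by rewrite powR_gt0.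
have t1 : (q%:R : R) `^ (1 - s) < 1.
  by rewrite /powR gt_eqF// expR_lt1 nmulr_rlt0 ?ln_gt0// subr_lt0.
have [N1 hN1] := exists_geo_lt _ (absp a `^ s) _ _ t0 t1 e0.
have [||N2 hN2] := exists_geo_lt _ (absp a) q%:R^-1 _ _ _ d0.
- by rewrite invr_gt0.
- by rewrite invf_lt1.
(* [N1] makes the cost smaller than [e], [N2] the diameters smaller than [delta]. *)
pose n := maxn N1 N2; rewrite add0e.
apply: le_trans (hausdorff_delta_ball_le _ _ _ n s0 a0 _) _.
  by rewrite -exprVn ltW// hN2// leq_maxr.
rewrite lee_fin ltW//; apply: le_lt_trans (hN1 n (leq_maxl _ _)).
rewrite powRM ?invr_ge0 ?exprn_ge0 ?(ltW qR_gt0)// mulrCA ler_pM2l ?powR_gt0 ?absp_gt0//.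
rewrite -powR_invn ?(ltW qR_gt0)// -[q%:R ^+ n]powR_mulrn ?(ltW qR_gt0)//.
rewrite -[(_ `^ (1 - s)) ^+ n]powR_mulrn ?powR_ge0// -!powRrM -powRD.
  by rewrite mulrBl mul1r mulNr mulrC.
by rewrite (gt_eqF qR_gt0) implybT.
Qed.

(** * Digit expansions and the integral part *)

Definition digit_sum (n : nat) (d : nat -> F) : F :=
  \sum_(1 <= j < n.+1) d j / pi ^+ j.

Lemma digit_sumB n d e :
  digit_sum n d - digit_sum n e = \sum_(1 <= j < n.+1) (d j - e j) / pi ^+ j.
Proof. by rewrite -sumrB; apply: eq_bigr => j _; rewrite mulrBl. Qed.

Lemma absp_div_pi x j : absp (x / pi ^+ j) = absp x * q%:R ^+ j.
Proof. by rewrite abspM abspV abspX absp_pi exprVn invrK. Qed.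

Lemma absp_digitB c c' : c \in C -> c' \in C -> absp (c - c') <= 1.
Proof. by move=> cC c'C; rewrite abspD_le ?abspN ?absp_C. Qed.

(** Compare from the top: distinct digits at index n+1 contribute at least q^(n+1), while all lower
    terms together stay within q^n. *)
Lemma digit_sum_inj n (d e : nat -> F) :
  (forall j, d j \in C) -> (forall j, e j \in C) ->
  absp (digit_sum n d - digit_sum n e) <= 1 ->
  forall j, (0 < j <= n)%N -> d j = e j.
Proof.
move=> dC eC; elim: n => [_ [|j]//|n IH].
rewrite digit_sumB big_nat_recr//= -digit_sumB.
set S := _ - _ in IH *; set t := _ / _ => St1.
have Sn : absp S <= q%:R ^+ n.
  rewrite /S digit_sumB big_nat_cond; apply: absp_sum_le => [|j].
    by rewrite exprn_ge0// ltW.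
  rewrite andbT ltnS => /andP[_ jn]; rewrite absp_div_pi.
  rewrite -[leRHS]mul1r ler_pM ?exprn_ge0 ?(ltW qR_gt0) ?absp_digitB//.
  by rewrite ler_weXn2l// ltW.
have [de|de] := eqVneq (d n.+1) (e n.+1).
  have /IH{}IH : absp S <= 1 by move: St1; rewrite /t de subrr mul0r addr0.
  move=> j /andP[j0]; rewrite leq_eqVlt => /orP[/eqP->//|jn].
  by apply: IH; rewrite j0.
have : absp t <= q%:R ^+ n.
  rewrite -(addKr S t) abspD_le ?abspN//.
  by rewrite (le_trans St1)// exprn_ege1// ltW.
rewrite absp_div_pi exprS mulrA ger_pMl ?exprn_gt0// leNgt.
by rewrite (lt_le_trans qR_gt1)// ler_peMl ?(ltW qR_gt0)// absp_C_neq.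
Qed.

Lemma frac_sums_digit_sum n d : (forall j, d j \in C) ->
  frac_sums pi C (digit_sum n d).
Proof. by move=> dC; exists n, d. Qed.

Lemma digit_sum_pad m n d : (m <= n)%N ->
  digit_sum m d = digit_sum n (fun j => if (j <= m)%N then d j else 0).
Proof.
move=> mn; rewrite /digit_sum (@big_cat_nat _ _ _ m.+1 1 n.+1)//=.
rewrite [X in _ + X]big_nat_cond [X in _ + X]big1 ?addr0; last first.
  by move=> j /andP[/andP[mj _] _]; rewrite leqNgt mj mul0r.
rewrite !big_nat; apply: eq_bigr => j /andP[_].
by rewrite ltnS => ->.
Qed.

(** Uniqueness of the negative-index part, which makes the [xget] in [int_part] well determined.
    Padding with the digit 0 gives both sums a common length. *)
Lemma frac_sums_inj s t : frac_sums pi C s -> frac_sums pi C t ->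
  absp (s - t) <= 1 -> s = t.
Proof.
move=> [m [d [dC ->]]] [n [e [eC ->]]].
rewrite -!/(digit_sum _ _) (digit_sum_pad m (maxn m n)) ?leq_maxl//.
rewrite (digit_sum_pad n (maxn m n)) ?leq_maxr// => st.
apply: eq_big_nat => j jmn; congr (_ / _).
by apply: (digit_sum_inj _ _ _ _ _ st) => // i; case: ifP => // _; exact: C0.
Qed.

Lemma digit_sum_approx n x : absp x <= q%:R ^+ n ->
  exists2 d : nat -> F, (forall j, d j \in C) & absp (x - digit_sum n d) <= 1.
Proof.
elim: n x => [|n IH] x xn.
  by exists (fun=> 0); [move=> _; exact: C0|rewrite /digit_sum big_geq// subr0].
have p0 : pi ^+ n.+1 != 0 by rewrite expf_neq0.
have [|c cC xc] := exists_digit (x * pi ^+ n.+1).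
  by rewrite abspM abspX absp_pi exprVn ler_pdivrMr ?exprn_gt0// mul1r.
have [|d dC hd] := IH (x - c / pi ^+ n.+1).
  rewrite -{1}(mulfK p0 x) -mulrBl absp_div_pi [q%:R ^+ _]exprS mulrA.
  by rewrite ger_pMl ?exprn_gt0// -ler_pdivlMr// mul1r.
exists (fun j => if j == n.+1 then c else d j); first by move=> j; case: ifP.
rewrite /digit_sum big_nat_recr//= eqxx (@eq_big_nat _ _ _ _ _ _ (fun j => d j / pi ^+ j)).
  by rewrite opprD [- _ + _]addrC addrA.
by move=> j /andP[_ jn]; rewrite (ltn_eqF jn).
Qed.

Lemma int_partE x s : frac_sums pi C s -> absp (x - s) <= 1 ->
  int_part absp pi C x = x - s.
Proof.
move=> fs xs; rewrite /int_part; congr (_ - _).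
apply: xget_unique => // t [ft xt]; apply: frac_sums_inj => //.
by apply: (absp_dist_le x) => //; rewrite absp_distC.
Qed.

(** The coefficients of pi^(-1), ..., pi^(-m) range freely over [C]; those further out are copied
    from an expansion of [w]. *)
Lemma free_digits (m : nat) (w : F) : exists z : {ffun 'I_m -> 'I_q} -> F,
  [/\ forall d, frac_sums pi C (z d),
      forall d, absp (z d - w) <= q%:R ^+ m &
      forall d d', d != d' -> 1 < absp (z d - z d')].
Proof.
have [n0 wn0] := absp_le_expq w; pose n := maxn m n0.
have wn : absp w <= q%:R ^+ n.
  by rewrite (le_trans wn0)// ler_weXn2l ?leq_maxr// ltW.
have [e eC we] := digit_sum_approx n w wn.
(* Position j >= 1 reads digit j - 1 of [d]; the clash at j = 0 is harmless because [digit_sum]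
   starts at 1. *)
pose dig (d : {ffun 'I_m -> 'I_q}) j :=
  if insub j.-1 is Some k then nth 0 C (d k) else e j.
have digC d j : dig d j \in C.
  by rewrite /dig; case: insubP => // k _ _; rewrite mem_nth// size_C.
exists (fun d => digit_sum n (dig d)); split.
- by move=> d; exact: frac_sums_digit_sum.
- move=> d; apply: (absp_dist_le (digit_sum n e)); last first.
    by rewrite absp_distC (le_trans we)// exprn_ege1// ltW.
  rewrite digit_sumB big_nat_cond; apply: absp_sum_le => [|j].
    by rewrite exprn_ge0// ltW.
  rewrite andbT => /andP[j0 _]; rewrite absp_div_pi.
  have := absp_digitB _ _ (digC d j) (eC j); rewrite {1 2}/dig.
  case: insubP => [k|_ _]; last by rewrite subrr absp0 mul0r exprn_ge0// ltW.
  move=> jm _ h; rewrite -[leRHS]mul1r ler_pM ?exprn_ge0 ?(ltW qR_gt0)//.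
  by rewrite ler_weXn2l ?(ltW qR_gt1)//; case: (j) j0 jm.
- move=> d d' dd'; rewrite ltNge; apply: contra dd' => zz; apply/eqP/ffunP => k.
  have := digit_sum_inj n _ _ (digC d) (digC d') zz k.+1.
  rewrite /= (leq_trans (ltn_ord k)) ?leq_maxl// => /(_ isT).
  rewrite /dig /= valK => /eqP; rewrite nth_uniq ?size_C ?uniq_C//.
  by move=> /eqP/val_inj.
Qed.

(** * The power map on a sphere *)

Lemma absp_pos x : x != 0 -> 0 < absp x.
Proof. by rewrite absp_gt0. Qed.

Lemma absp_nat_le1 n : absp n%:R <= 1.
Proof. by elim: n => [|n IH]; rewrite ?absp0// -natr1 abspD_le// absp1. Qed.

(** Pigeonhole: two of the q + 1 integers 0, ..., q share a residue class, and M is their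
    difference. *)
Lemma exists_nat_absp_lt1 : exists M, (0 < M <= q)%N /\ absp M%:R < 1.
Proof.
have /choice[c hc] : forall n : nat, exists c, c \in C /\ absp (n%:R - c) <= q%:R^-1.
  by move=> n; have [c] := exists_digit n%:R (absp_nat_le1 n); exists c.
have : ~~ uniq [seq c n | n <- iota 0 q.+1].
  apply/negP => /uniq_leq_size h.
  have : (size [seq c n | n <- iota 0 q.+1] <= size C)%N.
    by apply: h => _ /mapP[n _ ->]; have [] := hc n.
  by rewrite size_map size_iota (size_C) ltnn.
move=> /(uniqPn 0)[i [j [ij]]]; rewrite size_map size_iota => jq.
have iq := ltn_trans ij jq.
rewrite !(nth_map 0%N) ?size_iota// !nth_iota// !add0n => cij.
exists (j - i)%N; split.
  by rewrite subn_gt0 ij leq_subLR (leq_trans (_ : j <= q)%N) ?leq_addl.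
rewrite natrB 1?ltnW//; apply: (@le_lt_trans _ _ q%:R^-1); last by rewrite invf_lt1.
apply: (absp_dist_le (c j)); first by have [] := hc j.
by rewrite absp_distC -cij; have [] := hc i.
Qed.

(** Induction through E_(k+1) = (x + h) E_k + (k+1) x^k h^2 for the second-order remainder E_k. The
    factor |x| on the left avoids the exponent k - 1. *)
Lemma absp_pow_taylor x h k : absp h <= absp x ->
  absp ((x + h) ^+ k.+1 - x ^+ k.+1 - k.+1%:R * x ^+ k * h) * absp x
    <= absp x ^+ k * absp h ^+ 2.
Proof.
move=> hx; elim: k => [|k IH].
  rewrite !expr1 expr0 mulr1 mul1r addrAC addrK subrr absp0 mul0r.
  by rewrite mulr_ge0 ?exprn_ge0.
rewrite -abspM; set E := (_ - _ - _) in IH.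
have -> : ((x + h) ^+ k.+2 - x ^+ k.+2 - k.+2%:R * x ^+ k.+1 * h) * x =
    (x + h) * (E * x) + k.+1%:R * x ^+ k.+1 * h ^+ 2.
  by rewrite /E !exprS -[k.+2%:R]natr1; ring.
apply: abspD_le.
  rewrite abspM exprS -mulrA ler_pM//; first by rewrite abspD_le.
  by rewrite abspM.
rewrite abspM [absp (_%:R * _)]abspM !abspX; apply: ler_wpM2r; first by rewrite exprn_ge0.
by apply: ler_piMl; rewrite ?exprn_ge0 ?absp_nat_le1.
Qed.

(** As k+1 is a unit, the linear Taylor term has size |x|^k |y - x| and strictly dominates the
    remainder. *)
Lemma absp_powB x y k : absp k.+1%:R = 1 -> absp (y - x) < absp x ->
  absp (y ^+ k.+1 - x ^+ k.+1) = absp x ^+ k * absp (y - x).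
Proof.
move=> k1 yx; have x0 : 0 < absp x by rewrite (le_lt_trans _ yx).
have := absp_pow_taylor x (y - x) k (ltW yx).
rewrite (_ : x + (y - x) = y); last by rewrite addrC subrK.
move=> hT; have [->|yx0] := eqVneq y x.
  by rewrite !subrr absp0 mulr0.
pose L := k.+1%:R * x ^+ k * (y - x).
have -> : absp x ^+ k * absp (y - x) = absp L by rewrite !abspM k1 mul1r abspX.
apply: absp_dist_eq; rewrite absp_distC -(ltr_pM2r x0).
apply: le_lt_trans hT _; rewrite !abspM k1 mul1r abspX -mulrA.
rewrite ltr_pM2l ?exprn_gt0// expr2 ltr_pM2l//.
by rewrite absp_pos// subr_eq0.
Qed.

(** Newton iteration on alpha y^(k+1) = z: each step shrinks the error bound by r / |x| <= 1/q and
    stays in the ball of radius r. *)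
Lemma newton_approx (alpha x z : F) (k m : nat) (r : R) :
  alpha != 0 -> absp k.+1%:R = 1 -> r * q%:R <= absp x -> 0 < r ->
  absp (alpha * x ^+ k.+1 - z) <= absp alpha * absp x ^+ k * r ->
  exists y, absp (y - x) <= r /\
    absp (alpha * y ^+ k.+1 - z) <= absp alpha * absp x ^+ k * (r / q%:R ^+ m).
Proof.
move=> a0 k1 rx r0 xz; elim: m => [|m [y [yx yz]]].
  by exists x; rewrite subrr absp0 expr0 divr1; split=> //; exact: ltW.
have rx' : r < absp x by rewrite (lt_le_trans _ rx)// ltr_pMr.
have absx0 : 0 < absp x := lt_trans r0 rx'.
have absy : absp y = absp x.
  by apply: absp_dist_eq; rewrite absp_distC (le_lt_trans yx).
have y0 : y != 0 by rewrite -absp_gt0 absy.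
have k0 : k.+1%:R != 0 :> F by rewrite -absp_gt0 k1.
set e := alpha * y ^+ k.+1 - z in yz.
(* The Newton correction: it cancels the linear term and leaves alpha times the Taylor remainder. *)
pose h := - (e / (alpha * (k.+1%:R * y ^+ k))).
have he : absp h <= r / q%:R ^+ m.
  rewrite abspN abspM abspV !abspM k1 mul1r abspX absy ler_pdivrMr 1?mulrC//.
  by rewrite mulr_gt0 ?exprn_gt0// absp_pos.
have rm : r / q%:R ^+ m <= r.
  by rewrite ler_pdivrMr ?exprn_gt0// ler_peMr ?exprn_ege1 ?(ltW qR_gt1) ?(ltW r0).
have hr : absp h <= r := le_trans he rm.
exists (y + h); split; first by rewrite addrAC abspD_le.
have hy : absp h <= absp y by rewrite absy (le_trans hr) ?ltW.
have := absp_pow_taylor y h k hy; set E := (_ - _ - _) => hE.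
have -> : alpha * (y + h) ^+ k.+1 - z = alpha * E.
  have : alpha * (k.+1%:R * y ^+ k) * h = - e.
    by rewrite /h mulrN mulrC divfK ?mulf_neq0 ?expf_neq0.
  rewrite /e /E => eh.
  by transitivity (alpha * (y + h) ^+ k.+1 - alpha * y ^+ k.+1 - - (alpha * y ^+ k.+1 - z));
    [ring|rewrite -eh; ring].
rewrite abspM -mulrA ler_pM2l ?absp_pos//.
rewrite -(ler_pM2r absx0) -{1}absy; apply: le_trans hE _.
rewrite absy -mulrA ler_pM2l ?exprn_gt0// expr2.
(* One factor |h| keeps the current precision; the other is bounded by r <= |x| / q and supplies the
   gain 1/q. *)
apply: (@le_trans _ _ (r / q%:R ^+ m * r)); first by rewrite ler_pM.
rewrite (_ : _ * absp x = r / q%:R ^+ m * (absp x / q%:R)); last first.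
  by rewrite exprS invfM; ring.
by rewrite ler_pM2l ?divr_gt0 ?exprn_gt0// ler_pdivlMr.
Qed.

(** The r-ball is mapped at scale q^m, leaving m free negative digits. A child is an approximate
    preimage of such a digit sum [z d]; its radius is mapped to q^-3, so [z d] remains the negative
    part on the whole child. Distinct [z d] are more than 1 apart, which separates the children. *)
Lemma children (alpha x : F) (k m : nat) (r : R) :
  alpha != 0 -> absp k.+1%:R = 1 -> r * q%:R <= absp x -> 0 < r ->
  absp alpha * absp x ^+ k * r = q%:R ^+ m ->
  exists y : {ffun 'I_m -> 'I_q} -> F,
  [/\ forall d, absp (y d - x) <= r,
      forall d u, absp (u - y d) <= r / q%:R ^+ (m + 3) ->
        absp (int_part absp pi C (alpha * u ^+ k.+1)) <= (q%:R ^+ 3)^-1 &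
      forall d d', d != d' -> r / q%:R ^+ (m + 3) < absp (y d - y d')].
Proof.
move=> a0 k1 rx r0 axr.
have [z [fz zx zz]] := free_digits m (alpha * x ^+ k.+1).
have /choice[y hy] : forall d, exists y, absp (y - x) <= r /\
    absp (alpha * y ^+ k.+1 - z d) <=
      absp alpha * absp x ^+ k * (r / q%:R ^+ (m + 3)).
  by move=> d; apply: newton_approx; rewrite // axr absp_distC.
have scale : absp alpha * absp x ^+ k * (r / q%:R ^+ (m + 3)) = (q%:R ^+ 3)^-1.
  by rewrite mulrA axr exprD invfM mulVKf// gt_eqF ?exprn_gt0.
have rx' : r < absp x by rewrite (lt_le_trans _ rx)// ltr_pMr.
have q3 : (q%:R ^+ 3)^-1 < 1 :> R by rewrite invf_lt1 ?exprn_gt0// exprn_egt1.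
have rm : r / q%:R ^+ (m + 3) <= r.
  by rewrite ler_pdivrMr ?exprn_gt0// ler_peMr ?exprn_ege1 ?(ltW qR_gt1) ?(ltW r0).
have absy d : absp (y d) = absp x.
  by apply: absp_dist_eq; rewrite absp_distC (le_lt_trans _ rx')//; have [] := hy d.
have near d u : absp (u - y d) <= r / q%:R ^+ (m + 3) ->
    absp (alpha * u ^+ k.+1 - z d) <= (q%:R ^+ 3)^-1.
  move=> uy; apply: (absp_dist_le (alpha * y d ^+ k.+1)).
    rewrite -mulrBr abspM absp_powB ?absy//; last first.
      by rewrite (le_lt_trans uy)// (le_lt_trans rm).
    rewrite mulrA -scale ler_wpM2l// mulr_ge0 ?exprn_ge0//.
  by rewrite -scale; have [] := hy d.
exists y; split.
- by move=> d; have [] := hy d.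
- move=> d u /near ud; rewrite (int_partE _ (z d))//.
  by rewrite (le_trans ud)// ltW.
- move=> d d' dd'; rewrite ltNge; apply/negP => yy.
  have := zz _ _ dd'; rewrite ltNge => /negP[].
  apply: le_trans (ltW q3); apply: (absp_dist_le (alpha * y d ^+ k.+1)).
    by rewrite absp_distC near// subrr absp0 divr_ge0 ?exprn_ge0 ?(ltW r0) ?(ltW qR_gt0).
  exact: near.
Qed.

(** * Failure of uniform distribution and the lower bound *)

(** At N = (N0+1) M + 1 at least N0 + 1 terms lie in D(0, q^-3), and N <= 2q (N0+1) <= q^2 (N0+1).
    The frequency is thus at least q^-2 for arbitrarily large N. *)
Lemma not_unif_distr (u : nat -> F) (M : nat) : (0 < M <= q)%N ->
  (forall j, (0 < j)%N -> absp (u (j * M).+1) <= (q%:R ^+ 3)^-1) ->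
  ~ unif_distr absp q u.
Proof.
move=> /andP[M0 Mq] hu /(_ 0); rewrite absp0 => /(_ ler01 3%N).
set P := fun n => absp (u n - 0) <= _; have cP j : (j <= count P (iota 1 (j * M).+1))%N.
  elim: j => [//|j IH]; rewrite mulSn addnC -addSn iotaD count_cat -addn1 leq_add//.
  rewrite -has_count; apply/hasP; exists (j.+1 * M).+1; last first.
    by rewrite /P subr0 hu.
  by rewrite mem_iota; apply/andP; split; nia.
have q0 := qR_gt0.
(* Being this close to the limit q^-3 would force a frequency below q^-2. *)
have e0 : 0 < (q%:R ^+ 2)^-1 - (q%:R ^+ 3)^-1 :> R.
  by rewrite subr_gt0 ltf_pV2 ?posrE ?exprn_gt0// ltr_eXn2l.
move=> /cvgrPdist_lt/(_ _ e0)[N0 _ hN]; pose N := (N0.+1 * M).+1.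
have NN : (N0 <= N)%N by rewrite /N; nia.
pose c := count P (iota 1 N).
have : `|(q%:R ^+ 3)^-1 - c%:R / N%:R| < (q%:R ^+ 2)^-1 - (q%:R ^+ 3)^-1 :> R.
  exact: hN _ NN.
rewrite distrC => /(le_lt_trans (ler_norm _)); rewrite ltrBlDr subrK.
apply/negP; rewrite -leNgt ler_pdivlMr ?ltr0n// ler_pdivrMl ?exprn_gt0//.
rewrite -natrX -natrM ler_nat; have := cP N0.+1; rewrite -/N -/c => cN.
have : (N <= q ^ 2 * N0.+1)%N.
  have h1 : (N0.+1 * M <= N0.+1 * q)%N by rewrite leq_mul2l Mq orbT.
  have h2 : (N0.+1 * (2 * q) <= N0.+1 * (q * q))%N by rewrite !leq_mul.
  by rewrite /N expnS expn1; have := q_gt1; nia.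
by move=> /leq_trans; apply; rewrite leq_mul2l cN orbT.
Qed.

Lemma hausdorff_measure_lt1 (alpha : F) (s : R) : alpha != 0 -> 0 <= s -> s < 1 ->
  hausdorff_measure absp s [set x : F | 1 < absp x /\
    ~ unif_distr absp q (fun n => int_part absp pi C (alpha * x ^+ n))] <> 0%E.
Proof.
move=> a0 s0 s1.
have [M [/andP[M0 Mq] M1]] := exists_nat_absp_lt1.
have [n1 an1] := absp_le_expq alpha^-1.
have [N1 sN1] : exists n : nat, 3 / (1 - s) < n%:R.
  by exists (Num.bound (3 / (1 - s))); rewrite archi_boundP// divr_ge0// subr_ge0 ltW.
(* [N1] secures the dimension count, [n1] the inequality r q <= q^L, and 4 keeps the subtraction in
   [m] exact and [m] positive. *)
pose L := (N1 + n1 + 4)%N; pose m := (L * M - 3)%N.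
have [L0 n1L] : (0 < L)%N /\ (n1 < L)%N by rewrite /L; lia.
have mE : (m + 3 = L * M)%N by rewrite /m /L; nia.
have [m0 N1m] : (0 < m)%N /\ (N1 <= m + 3)%N by rewrite mE /m /L; nia.
clearbody m L.
have absa : 0 < absp alpha := absp_pos _ a0.
pose rho : R := q%:R ^+ L.
have rho1 : 1 < rho by rewrite exprn_egt1// -lt0n.
have rho0 : 0 < rho := lt_trans ltr01 rho1.
(* With this [r], a ball of radius r t^j is mapped to radius q^-3 by alpha x^(jM+1) and to radius
   q^m by alpha x^((j+1)M+1). *)
pose r := (q%:R ^+ 3)^-1 / absp alpha.
pose t : R := (q%:R ^+ (m + 3))^-1.
have r0 : 0 < r by rewrite divr_gt0 ?invr_gt0 ?exprn_gt0.
have t0 : 0 < t by rewrite invr_gt0 exprn_gt0.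
have t1 : t < 1 by rewrite invf_lt1 ?exprn_gt0// exprn_egt1// addn3.
have rrho : r * q%:R <= rho.
  have : r <= q%:R ^+ n1.
    rewrite -[leRHS]mul1r ler_pM ?invr_ge0 ?exprn_ge0 ?(ltW qR_gt0)//.
      by rewrite invf_le1 ?exprn_gt0// exprn_ege1// ltW.
    by rewrite -abspV.
  move=> /(ler_wpM2r (ltW qR_gt0))/le_trans; apply.
  by rewrite -exprSr /rho; apply: ler_weXn2l n1L; exact: ltW.
have rj j : r * t ^+ j <= r.
  by rewrite ler_piMr ?(ltW r0)// exprn_ile1 ?ltW.
have jM1 j : absp (j * M).+1%:R = 1.
  rewrite -absp1; apply: absp_dist_eq; rewrite -natr1 opprD addrC subrK abspN absp1.
  rewrite natrM abspM; apply: le_lt_trans M1; rewrite ler_piMl//.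
  exact: absp_nat_le1 _.
pose x0 := pi^-1 ^+ L.
have absx0 : absp x0 = rho by rewrite abspX abspV absp_pi invrK.
(* Level 0 fixes only the sphere, since the starting centre [x0] is not adapted to [alpha]. *)
pose G j x := absp x = rho /\ ((0 < j)%N -> forall u, absp (u - x) <= r * t ^+ j ->
  absp (int_part absp pi C (alpha * u ^+ (j * M).+1)) <= (q%:R ^+ 3)^-1).
have rr : r < rho by rewrite (lt_le_trans _ rrho)// ltr_pMr.
have abs_eq x y j : absp x = rho -> absp (y - x) <= r * t ^+ j -> absp y = rho.
  move=> xr yx; rewrite -xr; apply: absp_dist_eq.
  by rewrite absp_distC xr (le_lt_trans yx)// (le_lt_trans (rj j)).
apply: (hausdorff_measure_neq0 {ffun 'I_m -> 'I_q} G s r t x0) => //.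
- rewrite card_ffun !card_ord.
  exact: leq_trans q_gt1 (leq_pexp2l (ltnW q_gt1) m0).
- rewrite card_ffun !card_ord natrX /t -powR_invn ?(ltW qR_gt0)//.
  rewrite -[q%:R ^+ m]powR_mulrn ?(ltW qR_gt0)// -powRrM -powRD; last first.
    by rewrite (gt_eqF qR_gt0) implybT.
  rewrite -[leLHS](powRr0 q%:R) ler_powR ?(ltW qR_gt1)// mulNr subr_ge0.
  (* This says that the exponent m - (m+3) s of q in #|I| t^s is nonnegative. *)
  have h3 : 3 <= (m + 3)%:R * (1 - s).
    by rewrite -ler_pdivrMr ?subr_gt0// (le_trans (ltW sN1))// ler_nat.
  by move: h3; rewrite natrD; lra.
- move=> j x [xr _].
  have [|||y [yx yI yy]] := children alpha x (j.+1 * M) m (r * t ^+ j) a0 (jM1 _).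
  + by rewrite xr (le_trans _ rrho)// ler_wpM2r// ltW.
  + by rewrite mulr_gt0 ?exprn_gt0.
  + have -> : absp x ^+ (j.+1 * M) = (q%:R ^+ (m + 3)) ^+ j.+1.
      by rewrite xr -!exprM mE mulnCA mulnC.
    rewrite /r /t exprVn exprS exprD; field.
    by rewrite -exprD !gt_eqF ?exprn_gt0.
  exists y; split=> //.
  + move=> d; split; first by apply: abs_eq (yx d).
    by move=> _ u; rewrite exprSr mulrA; exact: yI.
  + by move=> d d' dd'; rewrite exprSr mulrA; exact: yy.
- move=> x y y0 Gy xy; split.
    by rewrite (abs_eq x0 x 0%N)// -y0.
  apply: (not_unif_distr _ M); first by rewrite M0.
  by move=> j j0; have [_] := Gy j; apply.
Qed.

End LocalField.

Theorem theorem1p7 (R : realType) (F : fieldType) (absp : F -> R)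
    (pi : F) (q : nat) (C : seq F)
    (hF : is_char0_local_field absp pi q C)
    (alpha : F) (halpha : alpha != 0) :
  hausdorff_dim absp
    [set x : F | 1 < absp x /\
       ~ unif_distr absp q (fun n => int_part absp pi C (alpha * x ^+ n))]
  = 1%:E.
Proof.
apply/eqP; rewrite eq_le; apply/andP; split.
  apply/lee_addgt0Pr => e e0; rewrite -EFinD; apply: ereal_inf_lbound.
  exists (1 + e) => //; split; first by rewrite addr_ge0// ltW.
  by apply: (hausdorff_measure_gt1 _ _ _ _ _ _ hF); rewrite ltrDl.
apply: le_ereal_inf_tmp => _ [s [s0 ms] <-]; rewrite lee_fin leNgt.
by apply/negP => s1; exact: (hausdorff_measure_lt1 _ _ _ _ _ _ hF _ _ halpha s0 s1 ms).
Qed.
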